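(* Let $R$ be a commutative ring with identity and $M$ an $R$-module such that every non-zerodivisor on $M$ is a non-zerodivisor of $R$, let $M^{\mathrm{reg}}$ be the set of non-zerodivisors on $M$, and let $k$ be a nonnegative integer. Then one has $$\operatorname{Int}^{(k)}(R,R(+)M)=\big(\operatorname{Int}_M^{(k)}(R)\cap\operatorname{Int}^{(k)}(R)\big)+\operatorname{Int}^{(k)}(R,M)\,\varepsilon$$ and $$\operatorname{Int}^{(k)}(R(+)M)=\big(\operatorname{Int}_M^{(k+1)}(R)\cap\operatorname{Int}^{(k)}(R)\big)+\operatorname{Int}^{(k)}(R,M)\,\varepsilon,$$ where also $$\operatorname{Int}_M^{(k)}(R)\cap\operatorname{Int}^{(k)}(R)=(M^{\mathrm{reg}})^{-1}R[X]\cap\operatorname{Int}^{(k)}(R)$$ and $$\operatorname{Int}_M^{(k+1)}(R)\cap\operatorname{Int}^{(k)}(R)=\{f\in\operatorname{Int}^{(k)}(R): f^{(k+1)}(R)M\subseteq M\}.$$ Moreover, one has canonical isomorphisms $$\operatorname{Int}^{(k)}(R,R(+)M)\cong\big(\operatorname{Int}_M^{(k)}(R)\cap\operatorname{Int}^{(k)}(R)\big)\,(+)\,\operatorname{Int}^{(k)}(R,M)$$ and $$\operatorname{Int}^{(k)}(R(+)M)\cong\big(\operatorname{Int}_M^{(k+1)}(R)\cap\operatorname{Int}^{(k)}(R)\big)\,(+)\,\operatorname{Int}^{(k)}(R,M).$$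
   Context: All rings are commutative with identity. For a ring $A$ and an $A$-module $N$, the idealization $A(+)N$ is the $A$-module $A\oplus N$ with multiplication $(a,n)(b,p)=(ab,ap+bn)$. For a ring $A$, $T(A)$ is its total quotient ring (localization at all non-zerodivisors). For $E\subseteq T(A)$, $\operatorname{Int}^{(k)}(E,A)=\{f\in T(A)[X]:f^{(j)}(E)\subseteq A\text{ for }0\le j\le k\}$, where $f^{(j)}$ is the $j$-th formal derivative, and $\operatorname{Int}^{(k)}(A)=\operatorname{Int}^{(k)}(A,A)$. An element $a\in R$ is a non-zerodivisor on $M$ if $am=0$ implies $m=0$ for all $m\in M$. Write $U=M^{\mathrm{reg}}$ for the multiplicative set of all such elements, and $T(M)=U^{-1}M\supseteq M$. The notation $(M^{\mathrm{reg}})^{-1}R[X]$ means $(U^{-1}R)[X]$. $M[X]$ denotes the polynomials $\sum_i X^im_i$ with coefficients $m_i\in M$; such an $h$ is evaluated at $x\in R$ by $h(x)=\sum_i x^im_i$, and formal derivatives are defined as usual; likewise for $T(M)[X]$. Define $$\operatorname{Int}^{(k)}(R,M)=\{h\in T(M)[X]: h^{(j)}(R)\subseteq M\text{ for }0\le j\le k\},$$ $$\operatorname{Int}_M^{(k)}(R)=\{f\in(U^{-1}R)[X]: f^{(j)}(R)M\subseteq M\text{ for }0\le j\le k\},$$ where elements of $U^{-1}R$ act on $M\subseteq U^{-1}M$ through the $U^{-1}R$-module structure of $U^{-1}M$. The set $\operatorname{Int}^{(k)}(R,M)$ is a module over $\operatorname{Int}^{(l)}_M(R)$ for $l\ge k$.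 Under the hypothesis on $M$, $U$ consists of non-zerodivisors of $R$, so $U^{-1}R\subseteq T(R)$, and $T(R(+)M)$ is identified with $U^{-1}R(+)U^{-1}M$. Elements $(x,m)$ of the idealization are written $x+m\varepsilon$ (with $x$ identified with $(x,0)$), and $f+h\varepsilon$, for $f=\sum f_iX^i\in(U^{-1}R)[X]$ and $h=\sum X^ih_i\in(U^{-1}M)[X]$, denotes the polynomial $\sum_i X^i(f_i,h_i)$ in $(U^{-1}R(+)U^{-1}M)[X]$; $C+D\varepsilon$ denotes $\{f+h\varepsilon:f\in C,h\in D\}$. In $\operatorname{Int}^{(k)}(R,R(+)M)$, $R$ is regarded as a subset of the ring $R(+)M$.
   Formalization: In the fourth identity f is also required to lie in (M^reg)^{-1}R[X]; for f merely in Int^(k)(R) it fails (R = Z, M = Z/p, k = 0, f = (X^p-X)^2/p). The ring R is assumed nonzero. *)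

(* Defs.v *)
From HB Require Import structures.
From mathcomp Require Import all_boot all_algebra.
From mathcomp Require Import boolp classical_sets functions.
From mathcomp Require Import ring.

Set Implicit Arguments.
Unset Strict Implicit.
Unset Printing Implicit Defensive.

Import GRing.Theory.
Local Open Scope ring_scope.
Local Open Scope classical_set_scope.
Local Open Scope quotient_scope.

Definition idealization (R : comNzRingType) (M : lmodType R) : Type :=
  (R * M)%type.

Notation "R (+) M" := (@idealization R%type M%type) : type_scope.

Section Idealization.
Variables (R : comNzRingType) (M : lmodType R).
Local Notation A := (R (+) M)%type.

HB.instance Definition _ := GRing.Zmodule.copy A (R * M)%type.

Definition ideal1 : A := (1, 0).
Definition idealM (x y : A) : A := (x.1 * y.1, x.1 *: y.2 + y.1 *: x.2).

Fact idealMA : associative idealM.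
Proof.
move=> [a m] [b n] [c p]; rewrite /idealM /= mulrA !scalerDr !scalerA addrA.
by rewrite (mulrC c a) (mulrC c b).
Qed.

Fact idealMC : commutative idealM.
Proof. by move=> [a m] [b n]; rewrite /idealM /= mulrC addrC. Qed.

Fact ideal1M : left_id ideal1 idealM.
Proof. by move=> [a m]; rewrite /idealM /= mul1r scale1r scaler0 addr0. Qed.

Fact idealMDl : left_distributive idealM +%R.
Proof.
move=> [a m] [b n] [c p]; rewrite /idealM /= mulrDl scalerDl scalerDr.
by congr (_, _); rewrite addrACA.
Qed.

Fact ideal1_neq0 : ideal1 != 0.
Proof. by apply/eqP=> -[] /eqP; rewrite oner_eq0. Qed.

HB.instance Definition _ := GRing.Zmodule_isComNzRing.Build A
  idealMA idealMC ideal1M idealMDl ideal1_neq0.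

End Idealization.

Definition regmod (R : comNzRingType) : lmodType R :=
  GRing.Lmodule.clone R R^o _.

Fact scale_regular (R : comNzRingType) (a b : R) :
  a *: (b : regmod R) = a * b.
Proof. by []. Qed.

Record mulset (R : comNzRingType) := MulSet {
  in_mulset :> R -> Prop;
  mulset1 : in_mulset 1;
  mulsetM : forall s t, in_mulset s -> in_mulset t -> in_mulset (s * t);
  mulset0 : ~ in_mulset 0 }.

Section Localization.
Variables (R : comNzRingType) (S : mulset R).

Record denom := Denom { denom_val :> R; _ : `[< S denom_val >] }.
HB.instance Definition _ := [isSub for denom_val].
HB.instance Definition _ := [Choice of denom by <:].

Lemma denomP (s : denom) : S s.
Proof. by case: s => s Ss; apply/asboolP. Qed.

Definition mkDenom s (Ss : S s) : denom := Denom (asboolT Ss).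
Definition denom1 := mkDenom (mulset1 S).
Definition denomM (s t : denom) := mkDenom (mulsetM (denomP s) (denomP t)).

Section Module.
Variable V : lmodType R.

(* The multiplier [w] makes this an equivalence even if [S] contains
   zerodivisors on [V]. *)
Definition loc_rel (x y : V * denom) : bool :=
  `[< exists2 w : R, S w &
        w *: ((y.2 : R) *: x.1) = w *: ((x.2 : R) *: y.1) >].

Fact loc_rel_refl : reflexive loc_rel.
Proof. by move=> x; apply/asboolP; exists 1 => //; exact: mulset1. Qed.

Fact loc_rel_sym : symmetric loc_rel.
Proof.
by move=> x y; apply/asboolP/asboolP => -[w Sw e]; exists w.
Qed.

Fact loc_rel_trans : transitive loc_rel.
Proof.
move=> [y t] [x s] [z u] /asboolP[w Sw /= e] /asboolP[w' Sw' /= e'].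
apply/asboolP; exists (w * w' * denom_val t) => /=.
  by do !apply: mulsetM => //; exact: denomP.
rewrite !scalerA in e e' *.
have {}e := congr1 (GRing.scale (w' * denom_val u)) e.
have {}e' := congr1 (GRing.scale (w * denom_val s)) e'.
rewrite !scalerA in e e'.
transitivity ((w' * denom_val u * (w * denom_val t)) *: x).
  by congr (_ *: _); ring.
rewrite e; transitivity ((w * denom_val s * (w' * denom_val u)) *: y).
  by congr (_ *: _); ring.
by rewrite e'; congr (_ *: _); ring.
Qed.

Canonical loc_equiv := EquivRel loc_rel loc_rel_refl loc_rel_sym loc_rel_trans.

Definition loc := {eq_quot loc_rel}.
HB.instance Definition _ : EqQuotient _ loc_rel loc := EqQuotient.on loc.
HB.instance Definition _ := Choice.on loc.

Definition frac (v : V) (s : denom) : loc := \pi_loc (v, s).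

Definition loc_num (x : loc) : V := (repr x).1.
Definition loc_den (x : loc) : denom := (repr x).2.

Lemma frac_numden x : frac (loc_num x) (loc_den x) = x.
Proof. by rewrite /frac /loc_num /loc_den -surjective_pairing reprK. Qed.

Lemma fracP (x : loc) : exists v s, x = frac v s.
Proof. by exists (loc_num x), (loc_den x); rewrite frac_numden. Qed.

Lemma eq_frac v (s : denom) w (t : denom) : frac v s = frac w t <->
  exists2 u : R, S u & u *: ((t : R) *: v) = u *: ((s : R) *: w).
Proof.
split; first by move/eqP; rewrite /frac eqmodE => /asboolP.
by move=> e; apply/eqP; rewrite /frac eqmodE; apply/asboolP.
Qed.

Lemma eq_frac1 v (s : denom) w (t : denom) :
  (t : R) *: v = (s : R) *: w -> frac v s = frac w t.
Proof. by move=> e; apply/eq_frac; exists 1; rewrite ?e //; exact: mulset1. Qed.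

Definition loc0 : loc := frac 0 denom1.
Definition loc_opp (x : loc) : loc := frac (- loc_num x) (loc_den x).
Definition loc_add (x y : loc) : loc :=
  frac ((loc_den y : R) *: loc_num x + (loc_den x : R) *: loc_num y)
       (denomM (loc_den x) (loc_den y)).

Lemma loc_oppE v s : loc_opp (frac v s) = frac (- v) s.
Proof.
have /eq_frac[w Sw e] := frac_numden (frac v s).
by apply/eq_frac; exists w => //; rewrite !scalerN e.
Qed.

Lemma loc_addE v (s : denom) w (t : denom) : loc_add (frac v s) (frac w t) =
  frac ((t : R) *: v + (s : R) *: w) (denomM s t).
Proof.
have /eq_frac[a Sa e] := frac_numden (frac v s).
have /eq_frac[b Sb e'] := frac_numden (frac w t).
rewrite /loc_add.
move: (loc_num _) (loc_den _) (loc_num _) (loc_den _) e e'.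
move=> w' t' v' s' e e'.
apply/eq_frac; exists (a * b); first exact: mulsetM.
rewrite /= !scalerDr !scalerA in e e' *; congr (_ + _).
  transitivity ((b * denom_val t * denom_val t' * (a * denom_val s)) *: v').
    by congr (_ *: _); ring.
  by rewrite -[LHS]scalerA e scalerA; congr (_ *: _); ring.
transitivity ((a * denom_val s * denom_val s' * (b * denom_val t)) *: w').
  by congr (_ *: _); ring.
by rewrite -[LHS]scalerA e' scalerA; congr (_ *: _); ring.
Qed.

Fact loc_addA : associative loc_add.
Proof.
move=> x y z; have [a [s ->]] := fracP x; have [b [t ->]] := fracP y.
have [c [u ->]] := fracP z; rewrite !loc_addE; apply: eq_frac1 => /=.
rewrite !scalerDr !scalerA addrA.
by congr (_ *: _ + _ *: _ + _ *: _); ring.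
Qed.

Fact loc_addC : commutative loc_add.
Proof.
move=> x y; have [a [s ->]] := fracP x; have [b [t ->]] := fracP y.
rewrite !loc_addE; apply: eq_frac1 => /=.
by rewrite addrC; congr (_ *: _); rewrite mulrC.
Qed.

Fact loc_add0 : left_id loc0 loc_add.
Proof.
move=> x; have [a [s ->]] := fracP x; rewrite loc_addE; apply: eq_frac1 => /=.
by rewrite scaler0 add0r scale1r mul1r.
Qed.

Fact loc_addN : left_inverse loc0 loc_opp loc_add.
Proof.
move=> x; have [a [s ->]] := fracP x; rewrite loc_oppE loc_addE.
by apply: eq_frac1 => /=; rewrite scalerN addNr !scaler0.
Qed.

HB.instance Definition _ :=
  GRing.isZmodule.Build loc loc_addA loc_addC loc_add0 loc_addN.

Lemma fracD v (s : denom) w (t : denom) :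
  frac v s + frac w t = frac ((t : R) *: v + (s : R) *: w) (denomM s t).
Proof. exact: loc_addE. Qed.

Lemma fracN v (s : denom) : - frac v s = frac (- v) s.
Proof. exact: loc_oppE. Qed.

Definition to_loc (v : V) : loc := frac v denom1.

End Module.

Lemma ring_fracP (a : loc (regmod R)) :
  exists (r : R) s, a = frac (r : regmod R) s.
Proof. by have [r [s e]] := fracP a; exists r, s. Qed.

Section Scale.
Variable V : lmodType R.

Definition loc_scale (a : loc (regmod R)) (x : loc V) : loc V :=
  frac ((loc_num a : R) *: loc_num x) (denomM (loc_den a) (loc_den x)).

Lemma loc_scaleE (r : R) s (v : V) t :
  loc_scale (frac (r : regmod R) s) (frac v t) = frac (r *: v) (denomM s t).
Proof.
have /eq_frac[a Sa e] := frac_numden (frac (r : regmod R) s).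
have /eq_frac[b Sb e'] := frac_numden (frac v t).
rewrite /loc_scale.
move: (loc_num _) (loc_den _) (loc_num _) (loc_den _) e e'.
move=> v' t' r' s' e e'.
apply/eq_frac; exists (a * b); first exact: mulsetM.
have {}e : a * (denom_val s * (r' : R)) = a * (denom_val s' * r) by [].
rewrite /= !scalerA in e' *.
transitivity ((a * (denom_val s * (r' : R)) * (b * denom_val t)) *: v').
  by congr (_ *: _); ring.
rewrite e -[LHS]scalerA e' scalerA; congr (_ *: _); ring.
Qed.

Local Opaque loc_scale.

Lemma loc_scaleDl (x : loc V) a b :
  loc_scale (a + b) x = loc_scale a x + loc_scale b x.
Proof.
have [r [s ->]] := ring_fracP a; have [q [t ->]] := ring_fracP b.
have [v [u ->]] := fracP x.
rewrite fracD !loc_scaleE fracD; apply: eq_frac1 => /=.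
by rewrite scalerDl !scalerDr !scalerA /= !scale_regular;
   congr (_ *: _ + _ *: _); ring.
Qed.

Lemma loc_scaleDr a (x y : loc V) :
  loc_scale a (x + y) = loc_scale a x + loc_scale a y.
Proof.
have [r [s ->]] := ring_fracP a; have [v [t ->]] := fracP x.
have [w [u ->]] := fracP y.
rewrite fracD !loc_scaleE fracD; apply: eq_frac1 => /=.
by rewrite !scalerDr !scalerA; congr (_ *: _ + _ *: _); ring.
Qed.

Lemma loc_scale1 (x : loc V) : loc_scale (to_loc (1 : regmod R)) x = x.
Proof.
have [v [u ->]] := fracP x; rewrite loc_scaleE; apply: eq_frac1 => /=.
by rewrite scale1r mul1r.
Qed.
End Scale.
Local Opaque loc_scale.

Lemma loc_scaleA (V : lmodType R) a b (x : loc V) :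
  loc_scale a (loc_scale b x) = loc_scale (loc_scale a b) x.
Proof.
have [r [s ->]] := ring_fracP a; have [q [t ->]] := ring_fracP b.
have [v [u ->]] := fracP x; rewrite !loc_scaleE; apply: eq_frac1 => /=.
rewrite !scalerA; congr (_ *: _).
by rewrite scale_regular; ring.
Qed.

Lemma loc_scaleC (a b : loc (regmod R)) : loc_scale a b = loc_scale b a.
Proof.
have [r [s ->]] := ring_fracP a; have [q [t ->]] := ring_fracP b.
rewrite !loc_scaleE; apply: eq_frac1 => /=.
by rewrite !scale_regular; ring.
Qed.

Definition ring_loc := loc (regmod R).
HB.instance Definition _ := GRing.Zmodule.on ring_loc.

Fact loc1_neq0 : to_loc (1 : regmod R) != 0 :> ring_loc.
Proof.
apply/eqP => /eq_frac[w Sw e]; apply: (@mulset0 _ S).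
have {}e : w * (1 * 1) = w * (1 * 0) by [].
by rewrite !mul1r mulr1 mulr0 in e; rewrite -e.
Qed.

HB.instance Definition _ := GRing.Zmodule_isComNzRing.Build ring_loc
  (@loc_scaleA (regmod R)) loc_scaleC (@loc_scale1 (regmod R))
  (fun a b x => loc_scaleDl x a b)
  loc1_neq0.

HB.instance Definition _ (V : lmodType R) :=
  GRing.Zmodule_isLmodule.Build ring_loc (loc V)
    (@loc_scaleA V) (@loc_scale1 V) (@loc_scaleDr V) (@loc_scaleDl V).

Definition rfrac (r : R) (s : denom) : ring_loc := @frac (regmod R) r s.

Lemma rfracP (a : ring_loc) : exists r s, a = rfrac r s.
Proof. exact: ring_fracP. Qed.

Lemma eq_rfrac r (s : denom) q (t : denom) : rfrac r s = rfrac q t <->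
  exists2 u : R, S u & u * (denom_val t * r) = u * (denom_val s * q).
Proof. exact: eq_frac. Qed.

Lemma eq_rfrac1 r (s : denom) q (t : denom) :
  denom_val t * r = denom_val s * q -> rfrac r s = rfrac q t.
Proof.
by move=> e; apply/eq_rfrac; exists 1; [exact: mulset1 | rewrite e].
Qed.

Lemma rfracN r (s : denom) : - rfrac r s = rfrac (- r) s.
Proof. exact: fracN. Qed.

Lemma rfracD r (s : denom) q (t : denom) : rfrac r s + rfrac q t =
  rfrac (denom_val t * r + denom_val s * q) (denomM s t).
Proof. exact: fracD. Qed.

Lemma rfracM r (s : denom) q (t : denom) :
  rfrac r s * rfrac q t = rfrac (r * q) (denomM s t).
Proof. exact: loc_scaleE. Qed.

Lemma fracZ (V : lmodType R) r (s : denom) (v : V) (t : denom) :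
  rfrac r s *: frac v t = frac (r *: v) (denomM s t).
Proof. exact: loc_scaleE. Qed.

Definition to_ring_loc (r : R) : ring_loc := rfrac r denom1.

Lemma to_ring_loc1 : to_ring_loc 1 = 1. Proof. by []. Qed.

Fact to_ring_loc_is_additive : zmod_morphism to_ring_loc.
Proof.
move=> r q; rewrite rfracN rfracD; apply: eq_rfrac1 => /=.
by rewrite !mul1r.
Qed.

Fact to_ring_loc_is_monoid_morphism : monoid_morphism to_ring_loc.
Proof.
split=> // r q; rewrite [RHS]rfracM; apply: eq_rfrac1 => /=.
by rewrite mulr1.
Qed.

HB.instance Definition _ := GRing.isZmodMorphism.Build
  R ring_loc to_ring_loc to_ring_loc_is_additive.
HB.instance Definition _ := GRing.isMonoidMorphism.Build
  R ring_loc to_ring_loc to_ring_loc_is_monoid_morphism.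

End Localization.

Section Widen.
Variables (R : comNzRingType) (S S' : mulset R).
Hypothesis sub : forall s, S s -> S' s.

Definition widen_denom (s : denom S) : denom S' := mkDenom (sub (denomP s)).

Definition widen_loc (x : ring_loc S) : ring_loc S' :=
  rfrac (loc_num x : R) (widen_denom (loc_den x)).

Lemma widen_locE r (s : denom S) :
  widen_loc (rfrac r s) = rfrac r (widen_denom s).
Proof.
have /eq_rfrac[a Sa e] := frac_numden (rfrac r s).
by apply/eq_rfrac; exists a => //; exact: sub.
Qed.

Fact widen_loc_is_additive : zmod_morphism widen_loc.
Proof.
move=> a b; have [r [s ->]] := rfracP a; have [q [t ->]] := rfracP b.
by rewrite rfracN rfracD !widen_locE rfracN rfracD; exact: eq_rfrac1.
Qed.

Fact widen_loc_is_monoid_morphism : monoid_morphism widen_loc.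
Proof.
split; first by rewrite -to_ring_loc1 widen_locE; exact: eq_rfrac1.
move=> a b; have [r [s ->]] := rfracP a; have [q [t ->]] := rfracP b.
by rewrite rfracM !widen_locE rfracM; exact: eq_rfrac1.
Qed.

HB.instance Definition _ := GRing.isZmodMorphism.Build
  (ring_loc S) (ring_loc S') widen_loc widen_loc_is_additive.
HB.instance Definition _ := GRing.isMonoidMorphism.Build
  (ring_loc S) (ring_loc S') widen_loc widen_loc_is_monoid_morphism.

End Widen.

Definition nonzerodivisor_on (R : comNzRingType) (V : lmodType R) (a : R) :
    Prop :=
  forall v : V, a *: v = 0 -> v = 0.

Definition nonzerodivisor (R : comNzRingType) (a : R) : Prop :=
  nonzerodivisor_on (regmod R) a.

(* The hypothesis on [V] entails [0 \notin V^reg], so that the localization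
   of [R] is a nontrivial ring. *)
Section Regular.
Variables (R : comNzRingType) (V : lmodType R).
Hypothesis regV : forall a : R, nonzerodivisor_on V a -> nonzerodivisor a.

Fact nonzerodivisor_on1 : nonzerodivisor_on V 1.
Proof. by move=> v; rewrite scale1r. Qed.

Fact nonzerodivisor_onM a b :
  nonzerodivisor_on V a -> nonzerodivisor_on V b -> nonzerodivisor_on V (a * b).
Proof. by move=> ha hb v; rewrite -scalerA => /ha/hb. Qed.

Fact nonzerodivisor_on0 : ~ nonzerodivisor_on V 0.
Proof.
move=> /regV/(_ 1); rewrite scale0r => /(_ erefl)/eqP.
by rewrite (oner_eq0 R).
Qed.

Definition Mreg : mulset R :=
  MulSet nonzerodivisor_on1 nonzerodivisor_onM nonzerodivisor_on0.
End Regular.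

Definition Areg (A : comNzRingType) : mulset A :=
  @Mreg A (regmod A) (fun _ h => h).

Definition total_quotient (A : comNzRingType) := ring_loc (Areg A).
HB.instance Definition _ A := GRing.ComNzRing.on (total_quotient A).

Definition to_T (A : comNzRingType) (a : A) : total_quotient A :=
  to_ring_loc (Areg A) a.
HB.instance Definition _ A :=
  GRing.RMorphism.copy (@to_T A) (@to_ring_loc A (Areg A)).

Section ModPoly.
Variables (S : comNzRingType) (V : lmodType S).

Definition finitely_supported : {pred nat -> V} :=
  fun h => `[< exists n, forall i, (n <= i)%N -> h i = 0 >].

Fact finitely_supported_zmod_closed : zmod_closed finitely_supported.
Proof.
split=> [|g h /asboolP[m gm] /asboolP[n hn]]; apply/asboolP; first by exists 0%N.
exists (maxn m n) => i; rewrite geq_max => /andP[/gm gi /hn hi].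
by rewrite [LHS]/= -[_ i]/(g i - h i) gi hi subrr.
Qed.
HB.instance Definition _ := GRing.isZmodClosed.Build (nat -> V)
  finitely_supported finitely_supported_zmod_closed.

(* [h i] is the coefficient of [X^i]. *)
Record modpoly := ModPoly {
  mcoef :> nat -> V;
  _ : mcoef \in finitely_supported }.
HB.instance Definition _ := [isSub for mcoef].
HB.instance Definition _ := [Choice of modpoly by <:].
HB.instance Definition _ := [SubChoice_isSubZmodule of modpoly by <:].

Implicit Types (h : modpoly) (p q : {poly S}) (x : S) (v : V).

Lemma mcoefD h1 h2 i : (h1 + h2) i = h1 i + h2 i. Proof. by []. Qed.
Lemma mcoefB h1 h2 i : (h1 - h2) i = h1 i - h2 i. Proof. by []. Qed.
Lemma mcoef0 i : (0 : modpoly) i = 0. Proof. by []. Qed.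

Lemma modpolyP h1 h2 : (forall i, h1 i = h2 i) -> h1 = h2.
Proof. by move=> e; apply/val_inj/funext. Qed.

Definition mkmodpoly (f : nat -> V) n (fn : forall i, (n <= i)%N -> f i = 0) :=
  ModPoly (asboolT (ex_intro _ n fn) : f \in finitely_supported).

Fact msize_subproof h : exists n, `[< forall i, (n <= i)%N -> h i = 0 >].
Proof. by case: h => h /= /asboolP[n hn]; exists n; apply/asboolP. Qed.

Definition msize h := ex_minn (msize_subproof h).

Lemma mcoef_default h i : (msize h <= i)%N -> h i = 0.
Proof. by rewrite /msize; case: ex_minnP => m /asboolP hm _; exact: hm. Qed.

Definition meval h x : V := \sum_(i < msize h) x ^+ i *: h i.

Fact mderiv_subproof h i : (msize h <= i)%N -> h i.+1 *+ i.+1 = 0.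
Proof. by move=> hi; rewrite mcoef_default ?mul0rn // leqW. Qed.
Definition mderiv h : modpoly := mkmodpoly (@mderiv_subproof h).
Definition mderivn n h : modpoly := iter n mderiv h.

Fact mscale_subproof p h i : (size p + msize h <= i)%N ->
  \sum_(j < i.+1) p`_j *: h (i - j)%N = 0.
Proof.
move=> hi; rewrite big1 // => j _.
have [hj|hj] := leqP (size p) j; first by rewrite nth_default ?scale0r.
rewrite mcoef_default ?scaler0 // leq_subRL; last by rewrite -ltnS.
by apply: leq_trans hi; rewrite leq_add2r ltnW.
Qed.
Definition mscale p h : modpoly := mkmodpoly (@mscale_subproof p h).

Lemma mscaleE p h i : mscale p h i = \sum_(j < i.+1) p`_j *: h (i - j)%N.
Proof. by []. Qed.

Fact mscale_rev p h i : mscale p h i = \sum_(j < i.+1) p`_(i - j)%N *: h j.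
Proof.
rewrite [LHS]/= (reindex_inj rev_ord_inj) /=.
by apply: eq_bigr => j _; rewrite !subSS subKn // -ltnS.
Qed.

Fact mscaleA p q h : mscale p (mscale q h) = mscale (p * q) h.
Proof.
apply: modpolyP => i; rewrite [RHS]mscale_rev.
pose coef3 j k := p`_j *: (q`_(i - j - k)%N *: h k).
transitivity (\sum_(j < i.+1) \sum_(k < i.+1 | (k <= i - j)%N) coef3 j k).
  apply: eq_bigr => /= j _; rewrite [X in _ *: X]mscale_rev scaler_sumr.
  by rewrite (big_ord_narrow_leq (leq_subr _ _)).
rewrite (exchange_big_dep predT) //=; apply: eq_bigr => k _.
transitivity (\sum_(j < i.+1 | (j <= i - k)%N) coef3 j k).
  apply: eq_bigl => j; rewrite -ltnS -(ltnS j) -!subSn ?leq_ord //.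
  by rewrite -subn_gt0 -(subn_gt0 j) -!subnDA addnC.
rewrite (big_ord_narrow_leq (leq_subr _ _)) coefM scaler_suml /=.
by apply: eq_bigr => j _; rewrite /coef3 -!subnDA addnC scalerA.
Qed.

Fact mscale1 h : mscale 1 h = h.
Proof.
apply: modpolyP => i; rewrite /= big_ord_recl subn0 coef1 scale1r big1 ?addr0 //.
by move=> j _; rewrite coef1 scale0r.
Qed.

Fact mscaleDr p h1 h2 : mscale p (h1 + h2) = mscale p h1 + mscale p h2.
Proof.
apply: modpolyP => i; rewrite mcoefD !mscaleE -big_split.
by apply: eq_bigr => j _; rewrite /= -scalerDr.
Qed.

Fact mscaleDl h p q : mscale (p + q) h = mscale p h + mscale q h.
Proof.
apply: modpolyP => i; rewrite mcoefD !mscaleE -big_split.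
by apply: eq_bigr => j _; rewrite coefD scalerDl.
Qed.

HB.instance Definition _ := GRing.Zmodule_isLmodule.Build {poly S} modpoly
  mscaleA mscale1 mscaleDr mscaleDl.

Lemma mcoefZ p h i : (p *: h) i = \sum_(j < i.+1) p`_j *: h (i - j)%N.
Proof. exact: mscaleE. Qed.

Fact mderiv_is_additive : zmod_morphism mderiv.
Proof.
move=> g h; apply: modpolyP => i.
by rewrite mcoefB -[LHS]/((g - h) i.+1 *+ i.+1) mcoefB mulrnBl.
Qed.
HB.instance Definition _ :=
  GRing.isZmodMorphism.Build modpoly modpoly mderiv mderiv_is_additive.

Lemma mevalE n h x : (msize h <= n)%N -> meval h x = \sum_(i < n) x ^+ i *: h i.
Proof.
move=> hn; rewrite /meval (big_ord_widen n (fun i => x ^+ i *: h i)) //.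
rewrite big_mkcond; apply: eq_bigr => i _; case: ifPn => //.
by rewrite -leqNgt => /mcoef_default ->; rewrite scaler0.
Qed.

Lemma mevalD g h x : meval (g + h) x = meval g x + meval h x.
Proof.
pose n := maxn (msize (g + h)) (maxn (msize g) (msize h)).
rewrite !(@mevalE n) ?leq_max ?leqnn ?orbT // -big_split.
by apply: eq_bigr => i _; rewrite mcoefD scalerDr.
Qed.

Lemma meval0 x : meval 0 x = 0.
Proof. by apply: (addrI (meval 0 x)); rewrite -mevalD !addr0. Qed.

Lemma mevalN g x : meval (- g) x = - meval g x.
Proof. by apply: (addrI (meval g x)); rewrite -mevalD !subrr meval0. Qed.

Fact mconst_subproof v i : (1 <= i)%N -> (if i == 0%N then v else 0) = 0.
Proof. by case: i. Qed.
Definition mconst v : modpoly := mkmodpoly (@mconst_subproof v).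

Lemma mcoefZconst p v i : (p *: mconst v) i = p`_i *: v.
Proof.
rewrite mcoefZ big_ord_recr /= subnn eqxx big1 ?add0r // => j _.
by rewrite subn_eq0 leqNgt ltn_ord scaler0.
Qed.

Lemma modpoly_sum h : h = \sum_(i < msize h) 'X^i *: mconst (h i).
Proof.
apply: modpolyP => i.
have -> : (\sum_(j < msize h) 'X^j *: mconst (h j)) i =
          \sum_(j < msize h) ('X^j *: mconst (h j)) i.
  by elim/big_rec2: _ => [|j g c _ <-]; rewrite ?mcoef0 ?mcoefD.
have [hi|hi] := ltnP i (msize h).
  rewrite (bigD1 (Ordinal hi)) // mcoefZconst coefXn [_ == _]eqxx scale1r.
  rewrite big1 => [|j jNi]; [by rewrite /= addr0 | rewrite mcoefZconst coefXn].
  by rewrite -val_eqE /= eq_sym in jNi; rewrite (negPf jNi) scale0r.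
rewrite mcoef_default // big1 // => j _; rewrite mcoefZconst coefXn.
by rewrite gtn_eqF ?scale0r // (leq_trans _ hi).
Qed.

Lemma modpoly_ind (P : modpoly -> Prop) :
  (forall p v, P (p *: mconst v)) -> P 0 ->
  (forall g h, P g -> P h -> P (g + h)) -> forall h, P h.
Proof.
by move=> Pc P0 PD h; rewrite (modpoly_sum h); elim/big_ind: _.
Qed.

Lemma mevalZconst p v x : meval (p *: mconst v) x = p.[x] *: v.
Proof.
pose n := maxn (msize (p *: mconst v)) (size p).
rewrite (@mevalE n) ?leq_max ?leqnn // (@horner_coef_wide _ n) ?leq_maxr //.
rewrite scaler_suml; apply: eq_bigr => i _.
by rewrite mcoefZconst scalerA mulrC.
Qed.

Lemma mevalZ p h x : meval (p *: h) x = p.[x] *: meval h x.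
Proof.
elim/modpoly_ind: h => [q v||g h]; last 1 first.
- by rewrite scalerDr !mevalD => -> ->; rewrite scalerDr.
- by rewrite scalerA !mevalZconst hornerM scalerA.
by rewrite scaler0 !meval0 scaler0.
Qed.

Lemma mderivZconst p v : mderiv (p *: mconst v) = p^`() *: mconst v.
Proof.
apply: modpolyP => i; rewrite mcoefZconst coef_deriv -scalerMnl.
by rewrite -mcoefZconst.
Qed.

Lemma mderivZ p h : mderiv (p *: h) = p^`() *: h + p *: mderiv h.
Proof.
elim/modpoly_ind: h => [q v||g h]; last 1 first.
- rewrite !scalerDr !raddfD /= => -> ->.
  by rewrite addrACA.
- by rewrite scalerA !mderivZconst derivM scalerDl !scalerA.
by rewrite !(scaler0, raddf0) addr0.
Qed.

Lemma mderivnS n h : mderivn n.+1 h = mderivn n (mderiv h).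
Proof. exact: iterSr. Qed.

Fact mderivn_is_additive n : zmod_morphism (mderivn n).
Proof. by elim: n => // n IH g h; rewrite !mderivnS raddfB IH. Qed.
HB.instance Definition _ n :=
  GRing.isZmodMorphism.Build modpoly modpoly (mderivn n) (mderivn_is_additive n).

End ModPoly.

Lemma derivnM_closed (S : comNzRingType) (B : S -> Prop) (x : S) n :
  (forall a b, B a -> B b -> B (a + b)) ->
  (forall a b, B a -> B b -> B (a * b)) ->
  forall f g : {poly S},
    (forall j, (j <= n)%N -> B f^`(j).[x]) ->
    (forall j, (j <= n)%N -> B g^`(j).[x]) ->
    forall j, (j <= n)%N -> B (f * g)^`(j).[x].
Proof.
move=> BD BM f g Bf Bg j jn.
have {}Bf i : (i <= j)%N -> B f^`(i).[x] by move=> ij; apply/Bf/(leq_trans ij).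
have {}Bg i : (i <= j)%N -> B g^`(i).[x] by move=> ij; apply/Bg/(leq_trans ij).
elim: j f g Bf Bg {jn} => [|j IH] f g Bf Bg.
  by rewrite derivn0 hornerM; apply: BM; [apply: (Bf 0%N) | apply: (Bg 0%N)].
rewrite derivSn derivM derivnD hornerD; apply: BD; apply: IH => i ij.
- by rewrite -derivSn; exact: Bf.
- by apply: Bg; exact: leqW.
- by apply: Bf; exact: leqW.
- by rewrite -derivSn; exact: Bg.
Qed.

Lemma mderivnZ_closed (S : comNzRingType) (V : lmodType S)
    (B : S -> Prop) (D : V -> Prop) (x : S) n :
  (forall a b, D a -> D b -> D (a + b)) ->
  (forall a b, B a -> D b -> D (a *: b)) ->
  forall (f : {poly S}) (h : modpoly V),
    (forall j, (j <= n)%N -> B f^`(j).[x]) ->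
    (forall j, (j <= n)%N -> D (meval (mderivn j h) x)) ->
    forall j, (j <= n)%N -> D (meval (mderivn j (f *: h)) x).
Proof.
move=> DD DZ f h Bf Dh j jn.
have {}Bf i : (i <= j)%N -> B f^`(i).[x] by move=> ij; apply/Bf/(leq_trans ij).
have {}Dh i : (i <= j)%N -> D (meval (mderivn i h) x).
  by move=> ij; apply/Dh/(leq_trans ij).
elim: j f h Bf Dh {jn} => [|j IH] f h Bf Dh.
  by rewrite /= mevalZ; apply: DZ; [apply: (Bf 0%N) | apply: (Dh 0%N)].
rewrite mderivnS mderivZ raddfD mevalD; apply: DD; apply: IH => i ij.
- by rewrite -derivSn; exact: Bf.
- by apply: Dh; exact: leqW.
- by apply: Bf; exact: leqW.
- by rewrite -mderivnS; exact: Dh.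
Qed.

Section IntRing.
Variables (A : comNzRingType) (k : nat) (E : set (total_quotient A)).

Definition Int : set {poly total_quotient A} :=
  [set f | forall j, (j <= k)%N ->
           [set f^`(j).[x] | x in E] `<=` range (@to_T A)].

Definition Int_pred : {pred {poly total_quotient A}} := fun f => `[< Int f >].

Fact Int_subring_closed : subring_closed Int_pred.
Proof.
split=> [|f g /asboolP If /asboolP Ig|f g /asboolP If /asboolP Ig];
  apply/asboolP => j jk _ [x Ex <-].
- case: j jk => [|j] _; first by exists 1 => //; rewrite derivn0 hornerC rmorph1.
  by exists 0 => //; rewrite -polyC1 derivnC hornerC rmorph0.
- have [a _ ea] := If j jk _ (imageP _ Ex).
  have [b _ eb] := Ig j jk _ (imageP _ Ex).
  by exists (a - b) => //; rewrite derivnB hornerD hornerN rmorphB /= ea eb.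
- apply: (@derivnM_closed _ (range (@to_T A))) jk.
  + by move=> _ _ [a _ <-] [b _ <-]; exists (a + b) => //; rewrite rmorphD.
  + by move=> _ _ [a _ <-] [b _ <-]; exists (a * b) => //; rewrite rmorphM.
  + by move=> i ik; exact: If (imageP _ Ex).
  + by move=> i ik; exact: Ig (imageP _ Ex).
Qed.
HB.instance Definition _ := GRing.isSubringClosed.Build
  {poly total_quotient A} Int_pred Int_subring_closed.

Record int_ring := IntRing {
  int_val :> {poly total_quotient A};
  _ : int_val \in Int_pred }.
HB.instance Definition _ := [isSub for int_val].
HB.instance Definition _ := [Choice of int_ring by <:].
HB.instance Definition _ := [SubChoice_isSubComNzRing of int_ring by <:].

End IntRing.

Definition IntA (A : comNzRingType) (k : nat) := Int k (range (@to_T A)).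
Arguments IntA : clear implicits.

Section IntModule.
Variables (R : comNzRingType) (M : lmodType R).
Hypothesis regM : forall a : R, nonzerodivisor_on M a -> nonzerodivisor a.

Local Notation U := (Mreg regM).
Local Notation RU := (ring_loc U).
Local Notation TM := (loc U M).

Definition to_RU : R -> RU := to_ring_loc U.
Definition to_TM (m : M) : TM := to_loc U m.

Definition IntM (l : nat) : set {poly RU} :=
  [set f | forall j, (j <= l)%N -> forall (r : R) (m : M),
           range to_TM (f^`(j).[to_RU r] *: to_TM m)].

Definition IntRM (k : nat) : set (modpoly TM) :=
  [set h | forall j, (j <= k)%N -> forall r : R,
           range to_TM (meval (mderivn j h) (to_RU r))].

(* The inclusion [U^-1 R] in [T(R)]; it exists because of [regM]. *)
Definition RU_to_TR : RU -> total_quotient R :=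
  @widen_loc R U (Areg R) regM.
HB.instance Definition _ :=
  GRing.RMorphism.copy RU_to_TR (@widen_loc R U (Areg R) regM).

Lemma RU_to_TR_inj : injective RU_to_TR.
Proof.
move=> a b; have [r [s ->]] := rfracP a; have [q [t ->]] := rfracP b.
rewrite /RU_to_TR !widen_locE => /eq_rfrac[w regw /= e]; apply: eq_rfrac1.
apply/eqP; rewrite -subr_eq0; apply/eqP/regw.
by rewrite scale_regular mulrBr e subrr.
Qed.

Lemma RU_to_TR_to_RU r : RU_to_TR (to_RU r) = to_T r.
Proof. by rewrite /RU_to_TR widen_locE; exact: eq_rfrac1. Qed.

Definition RUX_to_TRX (f : {poly RU}) : {poly total_quotient R} :=
  map_poly RU_to_TR f.

(* [Int_M^(l)(R) /\ Int^(k)(R)], inside [T(R)[X]] *)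
Definition IntCap (l k : nat) : set {poly total_quotient R} :=
  (RUX_to_TRX @` IntM l) `&` IntA R k.

Lemma RUX_to_TRX_inj : injective RUX_to_TRX.
Proof.
move=> f g /polyP e; apply/polyP => i.
by have := e i; rewrite /RUX_to_TRX !coef_map => /RU_to_TR_inj.
Qed.

Lemma IntCapE l k f : IntCap l k (RUX_to_TRX f) <->
  IntM l f /\ IntA R k (RUX_to_TRX f).
Proof.
split=> [[[g Ig /RUX_to_TRX_inj <-] If]|[If Ik]]; first by [].
by split=> //; exists f.
Qed.

Lemma IntA_value k f : IntA R k (RUX_to_TRX f) <->
  forall j, (j <= k)%N -> forall r, range to_RU f^`(j).[to_RU r].
Proof.
split=> [If j jk r | If j jk _ [_ [r _ <-] <-]].
  have [a _ e] := If j jk _ (imageP _ (imageT (@to_T R) r)).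
  exists a => //; apply: RU_to_TR_inj.
  by rewrite RU_to_TR_to_RU e /RUX_to_TRX derivn_map -RU_to_TR_to_RU horner_map.
have [a _ e] := If j jk r; exists a => //.
by rewrite -!RU_to_TR_to_RU e /RUX_to_TRX derivn_map horner_map.
Qed.

Lemma to_TMZ r m : to_RU r *: to_TM m = to_TM (r *: m).
Proof.
rewrite /to_RU /to_ring_loc /to_TM /to_loc fracZ; apply: eq_frac1 => /=.
by rewrite mulr1.
Qed.

Lemma to_TMD m n : to_TM m + to_TM n = to_TM (m + n).
Proof.
rewrite /to_TM /to_loc fracD; apply: eq_frac1 => /=.
by rewrite !scale1r mulr1 scale1r.
Qed.

Lemma to_TMN m : - to_TM m = to_TM (- m).
Proof. exact: fracN. Qed.

Section CapRing.
Variables l k : nat.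

(* [Int_M^(l)(R) /\ Int^(k)(R)], inside [(U^-1 R)[X]] *)
Definition IntCap_pred : {pred {poly RU}} :=
  fun f => `[< IntCap l k (RUX_to_TRX f) >].

Fact IntCap_subring_closed : subring_closed IntCap_pred.
Proof.
have subA : subring_closed (@Int_pred R k (range (@to_T R))).
  exact: Int_subring_closed.
split=> [|f g /asboolP/IntCapE[Mf If] /asboolP/IntCapE[Mg Ig]
         |f g /asboolP/IntCapE[Mf If] /asboolP/IntCapE[Mg Ig]];
  apply/asboolP/IntCapE; (split; [move=> j jl r m|]).
- case: j jl => [|j] _; first by exists m => //; rewrite hornerC scale1r.
  exists 0 => //; rewrite -polyC1 derivnC hornerC scale0r.
  by apply: (addrI (to_TM 0)); rewrite to_TMD !addr0.
- by rewrite /RUX_to_TRX rmorph1; have [/asboolP] := subA.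
- have [a _ ea] := Mf j jl r m; have [b _ eb] := Mg j jl r m.
  exists (a - b) => //.
  by rewrite derivnB hornerD hornerN scalerBl -ea -eb to_TMN to_TMD.
- rewrite /RUX_to_TRX rmorphB; have [_ sB _] := subA.
  by apply/asboolP/sB; apply/asboolP.
- pose B (a : RU) := forall m, range to_TM (a *: to_TM m).
  apply: (@derivnM_closed RU B) jl m => [a b Ba Bb m|a b Ba Bb m|i il|i il].
  + have [c _ ec] := Ba m; have [d _ ed] := Bb m; exists (c + d) => //.
    by rewrite scalerDl -to_TMD ec ed.
  + by have [c _ ec] := Bb m; rewrite -scalerA -ec; exact: Ba.
  + by move=> m; exact: Mf.
  + by move=> m; exact: Mg.
- rewrite /RUX_to_TRX rmorphM; have [_ _ sM] := subA.
  by apply/asboolP/sM; apply/asboolP.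
Qed.
HB.instance Definition _ := GRing.isSubringClosed.Build
  {poly RU} IntCap_pred IntCap_subring_closed.

Record cap_ring := CapRing { cap_val :> {poly RU}; _ : cap_val \in IntCap_pred }.
HB.instance Definition _ := [isSub for cap_val].
HB.instance Definition _ := [Choice of cap_ring by <:].
HB.instance Definition _ := [SubChoice_isSubComNzRing of cap_ring by <:].

Definition IntRM_pred : {pred modpoly TM} := fun h => `[< IntRM k h >].

Fact IntRM_zmod_closed : zmod_closed IntRM_pred.
Proof.
split=> [|g h /asboolP Ig /asboolP Ih]; apply/asboolP => j jk r.
  by exists 0 => //; rewrite raddf0 meval0; apply: (addrI (to_TM 0));
     rewrite to_TMD !addr0.
have [a _ ea] := Ig j jk r; have [b _ eb] := Ih j jk r.
exists (a - b) => //.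
by rewrite raddfB mevalD mevalN -ea -eb to_TMN to_TMD.
Qed.
HB.instance Definition _ := GRing.isZmodClosed.Build (modpoly TM)
  IntRM_pred IntRM_zmod_closed.

(* [Int^(k)(R, M)] is a [cap_ring l k]-module for every [l]: for [f] in
   [Int^(k)(R)] the values of the first [k] derivatives of [f] lie in [R]. *)
Record IntRM_mod := IntRMMod {
  IntRM_val :> modpoly TM;
  _ : IntRM_val \in IntRM_pred }.
HB.instance Definition _ := [isSub for IntRM_val].
HB.instance Definition _ := [Choice of IntRM_mod by <:].
HB.instance Definition _ := [SubChoice_isSubZmodule of IntRM_mod by <:].

Fact IntRM_scale_subproof (f : cap_ring) (h : IntRM_mod) :
  (f : {poly RU}) *: (h : modpoly TM) \in IntRM_pred.
Proof.
case: f => f /= /asboolP/IntCapE[_ /IntA_value If].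
case: h => h /= /asboolP Ih; apply/asboolP => j jk r.
apply: (@mderivnZ_closed _ TM (range to_RU) (range to_TM)) jk.
- by move=> _ _ [a _ <-] [b _ <-]; exists (a + b) => //; rewrite to_TMD.
- by move=> _ _ [a _ <-] [b _ <-]; exists (a *: b) => //; rewrite to_TMZ.
- by move=> i ik; exact: If.
- by move=> i ik; exact: Ih.
Qed.

Definition IntRM_scale (f : cap_ring) (h : IntRM_mod) : IntRM_mod :=
  IntRMMod (IntRM_scale_subproof f h).

Fact IntRM_scaleA f g h :
  IntRM_scale f (IntRM_scale g h) = IntRM_scale (f * g) h.
Proof. by apply: val_inj; rewrite /= scalerA. Qed.

Fact IntRM_scale1 : left_id 1 IntRM_scale.
Proof. by move=> h; apply: val_inj; rewrite /= scale1r. Qed.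

Fact IntRM_scaleDr : right_distributive IntRM_scale +%R.
Proof. by move=> f g h; apply: val_inj; rewrite /= scalerDr. Qed.

Fact IntRM_scaleDl h : {morph IntRM_scale^~ h : f g / f + g}.
Proof. by move=> f g; apply: val_inj; rewrite /= scalerDl. Qed.

HB.instance Definition _ := GRing.Zmodule_isLmodule.Build cap_ring IntRM_mod
  IntRM_scaleA IntRM_scale1 IntRM_scaleDr IntRM_scaleDl.

End CapRing.

Local Notation A := (R (+) M)%type.
Local Notation TA := (total_quotient A).

Lemma nonzerodivisor_idealization (s : R) (n : M) :
  nonzerodivisor ((s, n) : A) <-> nonzerodivisor_on M s.
Proof.
split=> [rs m sm | rs [a m]].
  have e : ((s, n) : A) * (0, m) = 0.
    by rewrite [LHS]/GRing.mul /= /idealM /= mulr0 sm scale0r addr0.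
  by case: (rs (0, m) e).
rewrite scale_regular [LHS]/GRing.mul /= /idealM /= => -[sa].
have -> : a = 0 by apply: (regM rs).
by rewrite scale0r addr0 => /rs ->.
Qed.

Definition eps_denom (s : denom U) :
    denom (Areg A) :=
  @mkDenom A (Areg A) (denom_val s, 0)
    ((nonzerodivisor_idealization (denom_val s) 0).2 (denomP s)).

(* The identification of [U^-1 R (+) U^-1 M] with [T(R (+) M)]: [(r / u, m / v)]
   is mapped to [(v r, u m) / (u v, 0)]; see [identE] and [ident_bij]. *)
Definition ident (x : RU (+) TM) : TA :=
  rfrac (((loc_den x.2 : R) * loc_num x.1, (loc_den x.1 : R) *: loc_num x.2) : A)
        (eps_denom (denomM (loc_den x.1) (loc_den x.2))).

Lemma eq_RU r (u : denom U) q (v : denom U) :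
  rfrac r u = rfrac q v -> denom_val v * r = denom_val u * q.
Proof.
move=> /eq_rfrac[a Ua e]; apply/eqP; rewrite -subr_eq0; apply/eqP/(regM Ua).
by rewrite scale_regular mulrBr e subrr.
Qed.

Lemma eq_TM (m : M) (u : denom U) (n : M) (v : denom U) :
  frac m u = frac n v -> denom_val v *: m = denom_val u *: n.
Proof.
move=> /eq_frac[a Ua e]; apply/eqP; rewrite -subr_eq0; apply/eqP/Ua.
by rewrite scalerBr e subrr.
Qed.

Lemma idealME (a b : R) (m n : M) :
  ((a, m) : A) * ((b, n) : A) = (a * b, a *: n + b *: m).
Proof. by []. Qed.

Lemma identE r (u : denom U) (m : M) (v : denom U) :
  ident (rfrac r u, frac m v) =
  rfrac ((denom_val v * r, denom_val u *: m) : A) (eps_denom (denomM u v)).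
Proof.
have /eq_RU e := frac_numden (rfrac r u).
have /eq_TM e' := frac_numden (frac m v).
rewrite /ident /=; move: (loc_num _) (loc_den _) (loc_num _) (loc_den _) e e'.
move=> m' v' r' u' e e'; apply: eq_rfrac1; rewrite /= !idealME /= !scaler0 !addr0.
congr (_, _).
  transitivity (denom_val v * denom_val v' * (denom_val u * (r' : R))).
    by ring.
  by rewrite e; ring.
rewrite !scalerA.
transitivity ((denom_val u * denom_val u') *: (denom_val v *: m')).
  by rewrite scalerA; congr (_ *: _); ring.
by rewrite e' scalerA; congr (_ *: _); ring.
Qed.

Lemma idealDE (a b : R) (m n : M) :
  ((a, m) : A) + ((b, n) : A) = (a + b, m + n).
Proof. by []. Qed.

Lemma idealNE (a : R) (m : M) : - ((a, m) : A) = (- a, - m).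
Proof. by []. Qed.

Fact ident_is_additive : zmod_morphism ident.
Proof.
move=> [a x] [b y]; have [r [s ->]] := rfracP a; have [q [t ->]] := rfracP b.
have [m [u ->]] := fracP x; have [n [v ->]] := fracP y.
have -> : ((rfrac r s, frac m u) : RU (+) TM) - (rfrac q t, frac n v) =
          (rfrac r s - rfrac q t, frac m u - frac n v) by [].
rewrite rfracN rfracD fracN fracD !identE rfracN rfracD; apply: eq_rfrac1.
rewrite /= idealNE !idealME /= !scaler0 !addr0; congr (_, _).
  by ring.
by rewrite !(scalerDr, scalerN, scalerA) scaler0 addr0; congr (_ *: _ - _ *: _); ring.
Qed.

Fact ident_is_monoid_morphism : monoid_morphism ident.
Proof.
split.
  have -> : (1 : RU (+) TM) = (to_RU 1, to_TM 0) by [].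
  rewrite [LHS]identE -to_ring_loc1; apply: eq_rfrac1.
  rewrite /= mul1r mulr1 !mul1r scaler0; by [].
move=> [a x] [b y]; have [r [s ->]] := rfracP a; have [q [t ->]] := rfracP b.
have [m [u ->]] := fracP x; have [n [v ->]] := fracP y.
have -> : ((rfrac r s, frac m u) : RU (+) TM) * (rfrac q t, frac n v) =
  (rfrac r s * rfrac q t, rfrac r s *: frac n v + rfrac q t *: frac m u) by [].
rewrite rfracM !fracZ fracD !identE rfracM; apply: eq_rfrac1.
rewrite /= !idealME /= !scaler0 !addr0; congr (_, _); first by ring.
by rewrite !(scalerDr, scalerA) ?(scaler0, addr0); congr (_ *: _ + _ *: _); ring.
Qed.

HB.instance Definition _ := GRing.isZmodMorphism.Build
  (RU (+) TM)%type TA ident ident_is_additive.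
HB.instance Definition _ := GRing.isMonoidMorphism.Build
  (RU (+) TM)%type TA ident ident_is_monoid_morphism.

Lemma ident_inj : injective ident.
Proof.
move=> [a x] [b y]; have [r [s ->]] := rfracP a; have [q [t ->]] := rfracP b.
have [m [u ->]] := fracP x; have [n [v ->]] := fracP y.
rewrite !identE => /eq_rfrac[w rw]; set c := (X in w * X); set d := (X in _ = w * X).
move=> e; have {w rw e} : c = d.
  by apply/eqP; rewrite -subr_eq0; apply/eqP/rw; rewrite scale_regular mulrBr e subrr.
rewrite /c /d /= !idealME /= !scaler0 !addr0 => -[e e']; congr (_, _).
  apply/eq_rfrac; exists (denom_val u * denom_val v).
    by apply: (mulsetM (m := U)); exact: denomP.
  transitivity (denom_val t * denom_val v * (denom_val u * r)); first by ring.
  by rewrite e; ring.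
apply/eq_frac; exists (denom_val s * denom_val t).
  by apply: (mulsetM (m := U)); exact: denomP.
rewrite !scalerA in e' *.
transitivity ((denom_val t * denom_val v * denom_val s) *: m).
  by congr (_ *: _); ring.
by rewrite e'; congr (_ *: _); ring.
Qed.

Lemma ident_surj (z : TA) : exists x, ident x = z.
Proof.
have [[r m] [[[s n] d] ->]] := rfracP z; have ds := asboolW d.
pose s' : denom U :=
  @mkDenom R U s ((nonzerodivisor_idealization s n).1 ds).
exists (rfrac r s', frac (s *: m - r *: n) (denomM s' s')).
rewrite identE; apply: eq_rfrac1; rewrite /= !idealME; congr (_, _).
  by ring.
rewrite scaler0 addr0 !(scalerDr, scalerN, scalerA).
have -> : s * s * r = s * (s * r) by ring.
by rewrite subrK; congr (_ *: _); ring.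
Qed.

Lemma ident_bij : bijective ident.
Proof.
have [g gK] := choice ident_surj.
by exists g => // x; apply: ident_inj; rewrite gK.
Qed.

Lemma ident_to_T r m : ident (to_RU r, to_TM m) = to_T ((r, m) : A).
Proof.
rewrite [LHS]identE; apply: eq_rfrac1.
by rewrite /= !idealME /= !mul1r !scale1r !scaler0 addr0.
Qed.

(* [f + h eps], coefficientwise *)
Definition poly_eps (f : {poly RU}) (h : modpoly TM) : {poly RU (+) TM} :=
  \poly_(i < maxn (size f) (msize h)) ((f`_i, h i) : RU (+) TM).

Lemma coef_poly_eps f h i : (poly_eps f h)`_i = (f`_i, h i).
Proof.
rewrite coef_poly; case: ltnP => //; rewrite geq_max => /andP[fi hi].
by rewrite nth_default // mcoef_default.
Qed.

(* [f + h eps] as an element of [T(R (+) M)[X]] *)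
Definition eps (f : {poly RU}) (h : modpoly TM) : {poly TA} :=
  map_poly ident (poly_eps f h).

Definition eps_sum (C : set {poly total_quotient R}) (D : set (modpoly TM)) :
    set {poly TA} :=
  [set eps f h | f in RUX_to_TRX @^-1` C & h in D].

(* [R] as a subset of [R (+) M], inside [T(R (+) M)] *)
Definition R_in_TA : set TA := [set to_T ((r, 0) : A) | r in [set: R]].

End IntModule.

Arguments RUX_to_TRX {R M} regM f.
Arguments R_in_TA : clear implicits.
Arguments to_RU {R M} regM r.
Arguments to_TM {R M} regM m.
Arguments IntM {R M} regM l.
Arguments IntRM {R M} regM k.
Arguments IntCap {R M} regM l k.
Arguments cap_ring {R M} regM l k.
Arguments IntRM_mod {R M} regM k.
Arguments ident {R M} regM x.

(* Main.v *)
Require Import Defs.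
From HB Require Import structures.
From mathcomp Require Import all_boot all_algebra.
From mathcomp Require Import boolp classical_sets functions.

Set Implicit Arguments.
Unset Strict Implicit.
Unset Printing Implicit Defensive.

Import GRing.Theory.
Local Open Scope ring_scope.
Local Open Scope classical_set_scope.

(** Write [p = f + h eps] for a polynomial over [T(R (+) M)]; every polynomial
    over that ring has this form, for unique [f] over [U^-1 R] and [h] over
    [T(M)], because [T(R (+) M)] is [U^-1 R (+) U^-1 M].  As [eps] squares
    to zero, the first-order Taylor expansion is exact:
      [(f + h eps)(r + m eps) = f(r) + (h(r) + f'(r) m) eps],
    and differentiation acts on [f] and [h] separately.  Hence the [j]-th
    derivative of [p] takes a value in [R (+) M] at [r + m eps] exactly when
    [f^(j)(r)] is in [R] and [h^(j)(r) + f^(j+1)(r) m] is in [M]; this is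
    [eps_value], which carries everything else.

    On [R] only [m = 0] occurs and the two conditions separate into [f] in
    [Int^(k)(R)] and [h] in [Int^(k)(R, M)].  On [R (+) M], the value [m = 0]
    gives the same two conditions, and subtracting it from the value at a
    general [m] leaves [f^(j+1)(r) M] inside [M] for [j <= k].  Of these
    conditions on [f] only the one of order [k+1] is new, since a polynomial
    whose derivative of order [j] maps [R] to [R] satisfies [f^(j)(R) M] inside
    [M] for free ([IntA_IntM]); the two descriptions of the intersections
    express the same observation.

    Finally [(f, h) |-> f + h eps] turns the multiplication of an idealization
    into that of polynomials ([epsM]), so the two set equalities are ring
    isomorphisms. *)

(** * Arithmetic of an idealization *)

Section IdealizationArithmetic.
Variables (S : comNzRingType) (V : lmodType S).

Lemma idealization_sum n (F : 'I_n -> (S (+) V)%type) :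
  \sum_(i < n) F i = (\sum_(i < n) (F i).1, \sum_(i < n) (F i).2).
Proof. by elim/big_rec3: _ => [//|i x y z _ ->]. Qed.

Lemma idealization_mulrn (x : (S (+) V)%type) n :
  x *+ n = (x.1 *+ n, x.2 *+ n).
Proof. by elim: n => [//|n IH]; rewrite !mulrS IH. Qed.

(** The binomial formula stops after two terms, the square of [(0, t)] being
    zero; for [n = 0] the junk exponent [n.-1] is killed by the factor [n]. *)
Lemma idealization_exp (a : S) (t : V) n :
  ((a, t) : (S (+) V)%type) ^+ n = (a ^+ n, (a ^+ n.-1 *+ n) *: t).
Proof.
elim: n => [|n IH]; first by rewrite !expr0 mulr0n scale0r.
rewrite exprS IH [LHS]/GRing.mul /= /idealM /= -exprS; congr (_, _).
rewrite scalerA -scalerDl mulrS addrC; congr ((_ + _) *: _).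
by case: n {IH} => [|n]; rewrite ?mulr0n ?mulr0 //= mulrnAr -exprS.
Qed.

End IdealizationArithmetic.

(** * Polynomials over the idealization *)

Section Eps.
Variables (R : comNzRingType) (M : lmodType R).
Variable regM : forall a : R, nonzerodivisor_on M a -> nonzerodivisor a.

Local Notation U := (Mreg regM).
Local Notation RU := (ring_loc U).
Local Notation TM := (loc U M).
Local Notation A := (R (+) M)%type.
Implicit Types (f g : {poly RU}) (h : modpoly TM).

(** First-order Taylor expansion at [a]: the terms beyond [f'(a) t] and [h(a)]
    carry a factor [eps ^ 2]. *)
Lemma horner_poly_eps f h (a : RU) (t : TM) :
  (poly_eps f h).[((a, t) : (RU (+) TM)%type)] =
  (f.[a], meval h a + f^`().[a] *: t).
Proof.
pose n := maxn (size f) (msize h).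
have szf : (size f <= n)%N by exact: leq_maxl.
have szh : (msize h <= n)%N by exact: leq_maxr.
have szp : (size (poly_eps f h) <= n)%N by exact: size_poly.
have szd : (size f^`() <= n)%N.
  by apply: leq_trans szf; apply: leq_trans (leq_pred _); exact: size_poly.
(* The sums for [f] and [h] run to [n.+1], one step beyond the sizes, so that
   removing the index 0 leaves the sum for [f'], whose indices are shifted. *)
rewrite (horner_coef_wide _ (leqW szp)) idealization_sum.
rewrite (horner_coef_wide _ (leqW szf)) (horner_coef_wide _ szd).
rewrite (mevalE _ (leqW szh)) scaler_suml.
under eq_bigr => i _ do rewrite coef_poly_eps idealization_exp.
congr (_, _).
under eq_bigr => i _ do rewrite coef_poly_eps idealization_exp /= scalerA.
rewrite big_split /= addrC; congr (_ + _).
rewrite big_ord_recl /= mulr0n mulr0 scale0r add0r.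
by apply: eq_bigr => i _; rewrite coef_deriv mulrnAl mulrnAr.
Qed.

(** With [horner_poly_eps], the reason why the [j]-th derivative of [f + h eps]
    involves [f^(j+1)] at points outside [R]. *)
Lemma deriv_poly_eps f h :
  (poly_eps f h)^`() = poly_eps f^`() (mderiv h).
Proof.
apply/polyP => i; rewrite coef_deriv !coef_poly_eps idealization_mulrn.
by rewrite coef_deriv.
Qed.

Lemma derivn_eps f h j :
  (eps f h)^`(j) = eps f^`(j) (mderivn j h).
Proof.
rewrite /eps derivn_map; congr map_poly.
elim: j f h => [//|j IH] f h.
by rewrite !derivSn mderivnS deriv_poly_eps IH.
Qed.

Lemma eps_inj f g h (h' : modpoly TM) : eps f h = eps g h' -> f = g /\ h = h'.
Proof.
move=> /(map_inj_poly (@ident_inj _ _ regM) (rmorph0 _)) /polyP e.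
split; [apply/polyP => i | apply: modpolyP => i];
  by have := e i; rewrite !coef_poly_eps => -[].
Qed.

(** The coefficients are pulled back along the identification of
    [U^-1 R (+) U^-1 M] with [T(R (+) M)], one at a time. *)
Lemma eps_surj (p : {poly total_quotient A}) :
  exists f h, p = eps (regM := regM) f h.
Proof.
have [g gK] := choice (@ident_surj _ _ regM).
have sup i : (size p <= i)%N -> (g p`_i).2 = 0.
  move=> pi; suff -> : g p`_i = 0 by [].
  by apply: (@ident_inj _ _ regM); rewrite gK nth_default // rmorph0.
exists (\poly_(i < size p) (g p`_i).1), (mkmodpoly sup).
apply/polyP => i; rewrite coef_map coef_poly_eps coef_poly.
case: ltnP => pi; first by rewrite /= -surjective_pairing gK.
by rewrite [mkmodpoly _ i](sup i pi) nth_default //= rmorph0.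
Qed.

Lemma eps1 : eps (regM := regM) 1 0 = 1.
Proof.
rewrite -(rmorph1 (map_poly (ident regM))); congr map_poly.
by apply/polyP => i; rewrite coef_poly_eps !coef1; case: eqP.
Qed.

Lemma epsB f g h (h' : modpoly TM) :
  eps (f - g) (h - h') = eps f h - eps g h'.
Proof.
rewrite -rmorphB; congr map_poly; apply/polyP => i.
by rewrite coefB !coef_poly_eps coefB.
Qed.

(** The ring [(U^-1 R (+) U^-1 M)[X]] is the idealization of [(U^-1 R)[X]] by
    [(U^-1 M)[X]]: the [eps]-part of a Cauchy product is the sum of two Cauchy
    products, one of them with its factors reversed. *)
Lemma epsM f g h (h' : modpoly TM) :
  eps (f * g) (f *: h' + g *: h) = eps f h * eps g h'.
Proof.
rewrite -rmorphM; congr map_poly; apply/polyP => i.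
rewrite coefM idealization_sum coef_poly_eps coefM mcoefD.
congr (_, _).
  by apply: eq_bigr => j _; rewrite !coef_poly_eps.
rewrite [(g *: h) i]mscale_rev mcoefZ -big_split /=.
by apply: eq_bigr => j _; rewrite !coef_poly_eps.
Qed.

(** * Integer-valued polynomials *)

Lemma range_to_T_ident (a : RU) (t : TM) :
  range (@to_T A) (ident regM (a, t)) <->
  range (to_RU regM) a /\ range (to_TM regM) t.
Proof.
split=> [[[r m] _] | [[r _ <-] [m _ <-]]]; last first.
  by exists (r, m) => //; rewrite ident_to_T.
by rewrite -(ident_to_T regM) => /ident_inj [<- <-]; split; eexists.
Qed.

Lemma range_to_TMD (t u : TM) :
  range (to_TM regM) t -> range (to_TM regM) u -> range (to_TM regM) (t + u).
Proof. by move=> [m _ <-] [n _ <-]; exists (m + n) => //; rewrite to_TMD. Qed.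

(** All the sets of integer-valued polynomials over [R (+) M] are decided by
    this condition, read at the points [r + m eps] of the evaluation set. *)
Lemma eps_value f h j (r : R) (m : M) :
  range (@to_T A) ((eps f h)^`(j).[to_T ((r, m) : A)]) <->
  range (to_RU regM) f^`(j).[to_RU regM r] /\
  range (to_TM regM) (meval (mderivn j h) (to_RU regM r) +
                      f^`(j.+1).[to_RU regM r] *: to_TM regM m).
Proof.
rewrite derivn_eps /eps -ident_to_T horner_map horner_poly_eps.
exact: range_to_T_ident.
Qed.

(** [M] is an [R]-submodule of [T(M)], so it is stable under the values of the
    derivatives as soon as these lie in [R]. *)
Lemma IntA_IntM k f : IntA R k (RUX_to_TRX regM f) -> IntM regM k f.
Proof.
move=> /IntA_value If j jk r m; have [a _ <-] := If j jk r.
by exists (a *: m) => //; rewrite to_TMZ.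
Qed.

Lemma IntM_succ k f : IntM regM k.+1 f <->
  IntM regM k f /\
  forall r m, range (to_TM regM) (f^`(k.+1).[to_RU regM r] *: to_TM regM m).
Proof.
split=> [If | [If Ik] j].
  by split=> [j jk|]; apply: If => //; exact: leqW.
by rewrite leq_eqVlt => /predU1P[->|] //; exact: If.
Qed.

Lemma Int_R_in_TA_eps k f h : Int k (R_in_TA R M) (eps f h) <->
  IntCap regM k k (RUX_to_TRX regM f) /\ IntRM regM k h.
Proof.
split=> [Ifh | [/IntCapE[_ /IntA_value If] Ih] j jk _ [_ [r _ <-] <-]].
  have val j r (jk : (j <= k)%N) := (eps_value f h j r 0).1
     (Ifh j jk _ (imageP _ (imageP _ (I : [set: R] r)))).
  have If : IntA R k (RUX_to_TRX regM f).
    by apply/IntA_value => j jk r; case: (val j r jk).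
  split; first by apply/IntCapE; split=> //; exact: IntA_IntM.
  by move=> j jk r; have [_] := val j r jk; rewrite scaler0 addr0.
apply/eps_value; split; first exact: If.
by rewrite scaler0 addr0; exact: Ih.
Qed.

(** The shift from [k] to [k.+1] in the condition on [f] comes from the term
    [f^(j+1)(r) m] in the value of the [j]-th derivative at [r + m eps]. *)
Lemma IntA_idealization_eps k f h : IntA A k (eps f h) <->
  IntCap regM k.+1 k (RUX_to_TRX regM f) /\ IntRM regM k h.
Proof.
split=> [Ifh | [/IntCapE[Mf /IntA_value If] Ih] j jk _ [_ [[r m] _ <-] <-]].
  have val j r m (jk : (j <= k)%N) := (eps_value f h j r m).1
     (Ifh j jk _ (imageP _ (imageT (@to_T A) ((r, m) : A)))).
  have Ih : IntRM regM k h.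
    by move=> j jk r; have [_] := val j r 0 jk; rewrite scaler0 addr0.
  have If : IntA R k (RUX_to_TRX regM f).
    by apply/IntA_value => j jk r; case: (val j r 0 jk).
  split=> //; apply/IntCapE; split=> //; apply/IntM_succ.
  split=> [|r m]; first exact: IntA_IntM.
  have [_ fhm] := val k r m (leqnn k); have [n _ hn] := Ih k (leqnn k) r.
  (* [f^(k+1)(r) m] is the difference of the [eps]-parts of the values at
     [r + m eps] and at [r]. *)
  rewrite -(addKr (to_TM regM n) (_ *: _)) {2}hn to_TMN.
  by apply: range_to_TMD => //; exists (- n).
apply/eps_value; split; first exact: If.
by apply: range_to_TMD; [exact: Ih | exact: Mf].
Qed.

(** By [eps_surj], a set of polynomials is a sum [C + D eps] once membership of
    [f + h eps] splits into conditions on [f] and on [h]. *)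
Lemma eps_sumE (C : set {poly total_quotient R}) (D : set (modpoly TM))
    (I : set {poly total_quotient A}) :
  (forall f h, I (eps f h) <-> C (RUX_to_TRX regM f) /\ D h) ->
  I = eps_sum C D.
Proof.
move=> IE; apply/seteqP; split=> [p | _ [f Cf [h Dh <-]]]; last exact/IE.
by have [f [h ->]] := eps_surj p => /IE[Cf Dh]; exists f => //; exists h.
Qed.

(** * The isomorphism with an idealization *)

Section Isomorphism.
Variables (l k : nat) (E : set (total_quotient A)).
Hypothesis IntE : forall f h, Int k E (eps f h) <->
  IntCap regM l k (RUX_to_TRX regM f) /\ IntRM regM k h.

Local Notation B := (cap_ring regM l k (+) IntRM_mod regM k)%type.

Fact eps_iso_subproof (x : B) :
  eps (x.1 : {poly RU}) (x.2 : modpoly TM) \in @Int_pred A k E.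
Proof.
by case: x => -[f /= /asboolP Cf] [h /= /asboolP Dh]; apply/asboolP/IntE.
Qed.

Definition eps_iso (x : B) : int_ring k E := IntRing (eps_iso_subproof x).

Fact eps_iso_is_additive : zmod_morphism eps_iso.
Proof. by move=> x y; apply: val_inj; rewrite rmorphB [RHS]/= -epsB. Qed.

Fact eps_iso_is_monoid_morphism : monoid_morphism eps_iso.
Proof.
split=> [|x y]; apply: val_inj; first by rewrite rmorph1 -eps1.
by rewrite rmorphM [RHS]/= -epsM.
Qed.

HB.instance Definition _ := GRing.isZmodMorphism.Build
  B (int_ring k E) eps_iso eps_iso_is_additive.
HB.instance Definition _ := GRing.isMonoidMorphism.Build
  B (int_ring k E) eps_iso eps_iso_is_monoid_morphism.

Lemma eps_iso_bij : bijective eps_iso.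
Proof.
have inj : injective eps_iso.
  move=> [f h] [g h'] /(congr1 val) /= /eps_inj[efg ehh'].
  by congr (_, _); exact: val_inj.
have surj (p : int_ring k E) : exists x, eps_iso x = p.
  case: p => p Ip; have [f [h pE]] := eps_surj p.
  have /IntE[Cf Dh] : Int k E (eps f h) by rewrite -pE; exact: asboolW Ip.
  exists (CapRing (asboolT Cf : f \in @IntCap_pred _ _ regM l k),
          IntRMMod (asboolT Dh : h \in @IntRM_pred _ _ regM k)).
  exact: val_inj.
have [g gK] := choice surj.
by exists g => // x; apply: inj; rewrite gK.
Qed.

Lemma int_ring_iso :
  exists phi : {rmorphism B -> int_ring k E},
    bijective phi /\ forall x, phi x = eps x.1 x.2 :> {poly _}.
Proof.
by exists (eps_iso : {rmorphism _ -> _}); split=> //; exact: eps_iso_bij.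
Qed.

End Isomorphism.

End Eps.

(** * Integer-valued polynomials of the idealization and on its base ring *)

Theorem theorem4p7 (R : comNzRingType) (M : lmodType R)
    (regM : forall a : R, nonzerodivisor_on M a -> nonzerodivisor a) (k : nat) :
  [/\ Int k (R_in_TA R M) = eps_sum (IntCap regM k k) (IntRM regM k),
      IntA (R (+) M)%type k = eps_sum (IntCap regM k.+1 k) (IntRM regM k),
      IntCap regM k k = range (RUX_to_TRX regM) `&` IntA R k,
      IntCap regM k.+1 k =
        [set RUX_to_TRX regM f | f in
          [set f | IntA R k (RUX_to_TRX regM f) /\
             forall (r : R) (m : M),
               range (to_TM regM)
                 (f^`(k.+1).[to_RU regM r] *: to_TM regM m)]] &
      (exists phi : {rmorphism (cap_ring regM k k (+) IntRM_mod regM k)%type ->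
                                 int_ring k (R_in_TA R M)},
         bijective phi /\ forall x, phi x = eps x.1 x.2 :> {poly _})
   /\ (exists phi : {rmorphism (cap_ring regM k.+1 k (+) IntRM_mod regM k)%type ->
                                 int_ring k (range (@to_T (R (+) M)%type))},
         bijective phi /\ forall x, phi x = eps x.1 x.2 :> {poly _})].
Proof.
split.
- by apply: eps_sumE => f h; exact: Int_R_in_TA_eps.
- by apply: eps_sumE => f h; exact: IntA_idealization_eps.
- apply/seteqP; split=> _ [[f _ <-] If]; split=> //.
  exists f => //; exact: IntA_IntM.
- apply/seteqP; split=> [_ [[f /IntM_succ[_ Mf] <-] If] | _ [f [If Mf] <-]].
    by exists f.
  by apply/IntCapE; split=> //; apply/IntM_succ; split=> //; exact: IntA_IntM.
- split; apply: int_ring_iso; first exact: Int_R_in_TA_eps.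
  exact: IntA_idealization_eps.
Qed.
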